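(* There exists a half-blind game $G=(S_1,S_2,A_1,A_2,p,F)$ with an initial state $i\in S_1$ such that $$\tfrac12=\mathrm{val}(i)<\mathrm{val}^f(i)=1 .$$
   Context: **Half-blind games.** A half-blind game is a tuple $G=(S_1,S_2,A_1,A_2,p,F)$ where $S_1,S_2$ are finite disjoint sets of states (controlled by Player 1, the maximizer, and Player 2, the minimizer), $A_1,A_2$ are finite disjoint nonempty sets of actions, $p$ maps $S_1\times A_1$ to $\Delta(S_2)$ and $S_2\times A_2$ to $\Delta(S_1)$ ($\Delta(X)$ is the set of probability distributions on $X$), and $F\subseteq S_1$ is the set of final states. The maximizer's pure strategies are finite words: $\Sigma_1=A_1^*$. The minimizer's strategies $\Sigma_2$ are all functions $\tau:(S_1A_1S_2A_2)^*S_1A_1S_2\to\Delta(A_2)$. For $w=a_1\cdots a_n\in\Sigma_1$, $\tau\in\Sigma_2$, $s\in S_1$, the measure $\mathbb{P}_s^{w,\tau}$ on $(S_1A_1S_2A_2)^nS_1$ gives to $h=s_1a_1t_1b_1\cdots s_na_nt_nb_ns_{n+1}$ with $s_1=s$ the probability $\prod_{j=1}^n p(s_j,a_j)(t_j)\,\tau(h_j)(b_j)\,p(t_j,b_j)(s_{j+1})$, $h_j=s_1a_1t_1b_1\cdots s_ja_jt_j$, and probability $0$ to histories whose initial state is not $s$ or whose $A_1$-letters do not spell $w$. $\mathbb{P}_s^{w,\tau}(F)$ is the probability that the last state $s_{n+1}$ belongs to $F$. **Mixed words.** $\Sigma_1^m=\Delta(A_1^* )$ is the set of mixed strategies of the maximizer;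 for $w\in\Sigma_1^m$, $\mathbb{P}_s^{w,\tau}(F)=\sum_{v\in A_1^*}w(v)\,\mathbb{P}_s^{v,\tau}(F)$. The value is $$\mathrm{val}(s)=\sup_{w\in\Sigma_1^m}\inf_{\tau\in\Sigma_2}\mathbb{P}_s^{w,\tau}(F)=\inf_{\tau\in\Sigma_2}\sup_{w\in\Sigma_1^m}\mathbb{P}_s^{w,\tau}(F)$$ (the equality is a known theorem for half-blind games). **Finite-memory strategies.** $\Sigma_2^f$ is the set of finite-memory strategies of the minimizer, i.e. those given by finite-state probabilistic transducers that read histories and output mixed actions in $\Delta(A_2)$: there is a finite set of memory states with an initial memory state, a stochastic matrix on memory states for each symbol of $S_1\cup A_1\cup S_2\cup A_2$ by which the memory is updated at random when the symbol is read, and a map from memory states to $\Delta(A_2)$ giving the mixed action played when it is the minimizer's turn. $\mathbb{P}_s^{w,\tau}$ is the resulting probability measure on plays. Set $$\mathrm{val}^f(s)=\inf_{\tau\in\Sigma_2^f}\ \sup_{w\in\Sigma_1}\ \mathbb{P}_s^{w,\tau}(F).$$ *)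

(* Defs.v *)
From HB Require Import structures.
From mathcomp Require Import all_boot all_order all_algebra.
From mathcomp Require Import all_classical all_reals all_analysis.

Set Implicit Arguments.
Unset Strict Implicit.
Unset Printing Implicit Defensive.

Import Order.TTheory GRing.Theory Num.Theory.
Local Open Scope classical_set_scope.
Local Open Scope ring_scope.

Record fdist (R : realType) (T : finType) := FDist {
  fdist_fun :> T -> R;
  fdist_ge0 : forall x, 0 <= fdist_fun x;
  fdist_sum1 : \sum_x fdist_fun x = 1 }.

(* Disjointness of the state sets and of the action sets is automatic: they   *)
(* are distinct components of the record, and the only place where they are   *)
(* put together is the sum type [symbol] below.                               *)
Record half_blind_game (R : realType) := HalfBlindGame {
  S1 : finType;
  S2 : finType;
  A1 : finType;
  A2 : finType;
  A1_gt0 : (0 < #|A1|)%N;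
  A2_gt0 : (0 < #|A2|)%N;
  trans1 : S1 -> A1 -> fdist R S2;
  trans2 : S2 -> A2 -> fdist R S1;
  final : {set S1} }.

Section HalfBlindGame.
Variables (R : realType) (G : half_blind_game R).

Definition round : finType := (S1 G * A1 G * S2 G * A2 G)%type.

(* (S1 A1 S2 A2)^n S1 *)
Definition history (n : nat) : finType := (n.-tuple round * S1 G)%type.

(* The j-th controlled-by-1 state, counted from 0; the default value of [nth] *)
(* makes the state of index n the last state of the history.                  *)
Definition hist_state n (h : history n) (j : nat) : S1 G :=
  nth h.2 [seq r.1.1.1 | r <- h.1] j.

Definition hist_word n (h : history n) : seq (A1 G) :=
  [seq r.1.1.2 | r <- h.1].

(* Mixed actions after a history in (S1 A1 S2 A2)^* S1 A1 S2. *)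
Definition strategy2 : Type :=
  seq round -> S1 G -> A1 G -> S2 G -> fdist R (A2 G).

Definition hist_prob (s : S1 G) (w : seq (A1 G)) (tau : strategy2)
    n (h : history n) : R :=
  if (hist_state h 0 == s) && (hist_word h == w) then
    \prod_(j < n)
      (let: (sj, aj, tj, bj) := tnth h.1 j in
       trans1 sj aj tj * tau (take j h.1) sj aj tj bj
       * trans2 tj bj (hist_state h j.+1))
  else 0.

Definition prob_final (s : S1 G) (w : seq (A1 G)) (tau : strategy2) : R :=
  \sum_(h : history (size w) | h.2 \in final G) hist_prob s w tau h.

Record mixed_word := MixedWord {
  mixed_word_fun :> seq (A1 G) -> R;
  mixed_word_ge0 : forall v, 0 <= mixed_word_fun v;
  mixed_word_sum1 :
    (\esum_(v in [set: seq (A1 G)]) (mixed_word_fun v)%:E = 1)%E }.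

Definition prob_final_mixed (s : S1 G) (w : mixed_word) (tau : strategy2) :
    \bar R :=
  \esum_(v in [set: seq (A1 G)]) (w v * prob_final s v tau)%:E.

Definition maxmin_value (s : S1 G) : \bar R :=
  ereal_sup (range (fun w : mixed_word =>
    ereal_inf (range (fun tau : strategy2 => prob_final_mixed s w tau)))).

Definition minmax_value (s : S1 G) : \bar R :=
  ereal_inf (range (fun tau : strategy2 =>
    ereal_sup (range (fun w : mixed_word => prob_final_mixed s w tau)))).

Inductive symbol :=
  | SymS1 of S1 G
  | SymA1 of A1 G
  | SymS2 of S2 G
  | SymA2 of A2 G.

(* [update x m] is the row of index m of the stochastic matrix of symbol x.   *)
Record transducer := Transducer {
  memory : finType;
  init_memory : memory;
  update : symbol -> memory -> fdist R memory;
  output : memory -> fdist R (A2 G) }.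

(* Probability that the transducer T, in memory state m before it reads the   *)
(* first symbol, plays the minimizer's actions of the given rounds when it is *)
(* fed with the other symbols: m1, m2, m3, m4 are the random memory states    *)
(* after the symbols s, a, t, b respectively, and b is drawn from the mixed   *)
(* action of the actual memory state m3. Reading the last state of a history  *)
(* does not change this probability and is omitted.                           *)
Fixpoint output_prob (T : transducer) (m : memory T) (h : seq round) : R :=
  if h is (s, a, t, b) :: h' then
    \sum_m1 (update (SymS1 s) m m1 *
      \sum_m2 (update (SymA1 a) m1 m2 *
        \sum_m3 (update (SymS2 t) m2 m3 * output m3 b *
          \sum_m4 (update (SymA2 b) m3 m4 * output_prob m4 h'))))
  else 1.

(* Law of the play, the memory of the transducer being summed out. *)
Definition hist_prob_fm (s : S1 G) (w : seq (A1 G)) (T : transducer)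
    n (h : history n) : R :=
  if (hist_state h 0 == s) && (hist_word h == w) then
    (\prod_(j < n)
      (let: (sj, aj, tj, bj) := tnth h.1 j in
       trans1 sj aj tj * trans2 tj bj (hist_state h j.+1)))
    * output_prob (init_memory T) h.1
  else 0.

Definition prob_final_fm (s : S1 G) (w : seq (A1 G)) (T : transducer) : R :=
  \sum_(h : history (size w) | h.2 \in final G) hist_prob_fm s w T h.

Definition finite_memory_value (s : S1 G) : \bar R :=
  ereal_inf [set x | exists T : transducer,
    x = ereal_sup (range (fun w : seq (A1 G) => (prob_final_fm s w T)%:E))].

End HalfBlindGame.

(* Main.v *)
Require Import Defs.
From HB Require Import structures.
From mathcomp Require Import all_boot all_order all_algebra.
From mathcomp Require Import all_classical all_reals all_analysis.
From mathcomp Require Import ring lra.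

(* The maximizer plays a sequence of trials. At the start of a trial the      *)
(* token is put on a line X, Y or Z with probabilities 1/4, 1/2 and 1/4.      *)
(* After the letters a^n b^m it is still on these lines with probabilities    *)
(* p 4^-n / 4, 2^-(n+m) / 2 and 4^-m / 4, where the minimizer, who may leave  *)
(* X after each b, controls p. Then Zero makes X win and Y, Z lose, and One   *)
(* makes Y win and X, Z lose; a token that is on no line enters the next      *)
(* trial. A minimizer who counts n and m keeps p = min(1, 2^(n+1-m)), and     *)
(* then losing is at least as likely as winning in every trial; and One alone *)
(* wins with probability 1/2 in the first trial. With finite memory, the      *)
(* probability p of staying on X after b^m decreases to a limit that is zero  *)
(* or bounded from below, uniformly in the memory state after a^n. So for     *)
(* large n either p is already small for m = n + k, and then One is good, or  *)
(* p stays bounded from below as m increases, and then Zero is good. In both  *)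
(* cases winning is arbitrarily many times likelier than losing, and trials   *)
(* are repeated until the token is absorbed.                                  *)

Set Implicit Arguments.
Unset Strict Implicit.
Unset Printing Implicit Defensive.

Import Order.TTheory GRing.Theory Num.Theory.
Local Open Scope ring_scope.

(** * Plays as iterated expectations *)

(** Everything turns on the balance at the end of a trial. Write A = 2^-n, B = 2^-m and let x/4 be
    the mass on X after a^n b^m. Then [Zero] wins at most what it loses iff x <= 2AB + B^2, and
    [One] does iff 2AB <= x + B^2. The counting minimizer keeps x = min(A^2, 2AB), which satisfies
    both, and [counting_prob_le] carries the bound 1/2 through the word by induction. As
    [prob_final_One_One] secures 1/2 against every strategy, [maxmin_le_minmax] squeezes both values
    to 1/2.

    Against a transducer, x as a function of m is an average of finitely many nonincreasing
    sequences, one for each configuration met at the first b, and these sequences do not depend on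
    n. Hence x cannot follow a curve that bends near m = n for every n: [nonincreasing_dominance]
    and [survival_dominance] give a dichotomy that is uniform in the law of the memory. [trial_gain]
    turns it into a word that wins a fixed fraction of the unresolved mass and loses at most d times
    what it wins, for d as small as desired; [repeated_trials] iterates this, and [fm_prob_sup] lets
    d and the unresolved mass tend to 0. *)

Lemma big_tuple_cons (R : nmodType) (T : finType) n
    (F : n.+1.-tuple T -> R) :
  \sum_(l : n.+1.-tuple T) F l =
  \sum_(r : T) \sum_(l : n.-tuple T) F [tuple of r :: l].
Proof.
rewrite pair_bigA /= (reindex (fun p : T * n.-tuple T => [tuple of p.1 :: p.2])) //=.
exists (fun l : n.+1.-tuple T => (thead l, [tuple of behead l])).
  by move=> [r l] _ /=; congr (_, _); apply/val_inj.
by move=> l _; rewrite -tuple_eta.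
Qed.

Section PlayWeight.
Variables (R : realType) (G : half_blind_game R).

(** Common form of [prob_final] and [prob_final_fm]: the minimizer enters only through a weight [wt]
    of the rounds played, so a single recursion on the word serves both. *)
Definition play_weight (wt : seq (round G) -> R) (s : S1 G) (w : seq (A1 G)) : R :=
  \sum_(h : history G (size w) | h.2 \in final G)
    if (hist_state h 0 == s) && (hist_word h == w) then
      (\prod_(j < size w)
        (let: (sj, aj, tj, bj) := tnth h.1 j in
         trans1 sj aj tj * trans2 tj bj (hist_state h j.+1)))
      * wt h.1
    else 0.

Lemma play_weight_tuple wt s w :
  play_weight wt s w =
  \sum_(l : (size w).-tuple (round G)) \sum_(e | e \in final G)
    if (hist_state (l, e) 0 == s) && (hist_word (l, e) == w) then
      (\prod_(j < size w)
        (let: (sj, aj, tj, bj) := tnth l j in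
         trans1 sj aj tj * trans2 tj bj (hist_state (l, e) j.+1)))
      * wt l
    else 0.
Proof.
by rewrite pair_big_dep /=; apply: eq_big => -[l e].
Qed.

Lemma play_weight_nil wt s : play_weight wt s [::] = (s \in final G)%:R * wt [::].
Proof.
rewrite play_weight_tuple (big_pred1 [tuple]); last first.
  by move=> l; rewrite (tuple0 l) [RHS]eqxx.
rewrite /hist_state /hist_word /=.
under eq_bigr do rewrite andbT big_ord0 mul1r.
rewrite -big_mkcondr /=.
have [sF|sF] := boolP (s \in final G).
  rewrite (big_pred1 s) ?mul1r// => e /=.
  by case: (eqVneq e s) => [->|]; rewrite ?sF ?andbF.
rewrite big_pred0 ?mul0r// => e.
by case: (eqVneq e s) => [->|]; rewrite ?(negbTE sF) ?andbF.
Qed.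

Lemma play_weight_cons wt s x w :
  play_weight wt s (x :: w) =
  \sum_t trans1 s x t * \sum_b \sum_s' trans2 t b s' *
    play_weight (fun l => wt ((s, x, t, b) :: l)) s' w.
Proof.
rewrite play_weight_tuple /= big_tuple_cons.
pose f t b (l : (size w).-tuple (round G)) e : R :=
  if hist_word (l, e) == w then
  trans1 s x t * trans2 t b (hist_state (l, e) 0) * (\prod_(j < size w)
        (let: (sj, aj, tj, bj) := tnth l j in
         trans1 sj aj tj * trans2 tj bj (hist_state (l, e) j.+1)))
      * wt ((s, x, t, b) :: l) else 0.
transitivity (\sum_t \sum_b \sum_(l : (size w).-tuple (round G))
   \sum_(e | e \in final G) f t b l e).
  (* Only first rounds that begin with [s] and [x] contribute. *)
  rewrite (eq_bigr (fun r : round G => if r.1.1 == (s, x) then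
     \sum_(l : (size w).-tuple (round G))
     \sum_(e | e \in final G) f r.1.2 r.2 l e else 0)); last first.
    move=> [[[s0 x0] t] b] _ /=; case: ifPn => [/eqP[-> ->]|ne].
      apply: eq_bigr => l _; apply: eq_bigr => e _.
      rewrite /f /hist_state /hist_word /= eqxx /= eqseq_cons eqxx /=.
      case: ifP => // _; rewrite big_ord_recl; congr (_ * _ * _).
      by apply: eq_bigr => j _; rewrite tnthS.
    rewrite big1 // => l _; rewrite big1 // => e _.
    rewrite /hist_state /hist_word /= eqseq_cons andbA.
    by rewrite -[(s0 == s) && _]/((s0, x0) == (s, x)) (negbTE ne).
  rewrite -big_mkcond /= [RHS]pair_bigA /=.
  rewrite (reindex (fun p : S2 G * A2 G => (s, x, p.1, p.2))) /=; last first.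
    exists (fun r : round G => (r.1.2, r.2)) => [[t b] _|] //=.
    by move=> [[[s0 x0] t] b] /eqP /= [-> ->].
  by apply: eq_big => [[t b]|//]; rewrite eqxx.
apply: eq_bigr => t _; rewrite mulr_sumr; apply: eq_bigr => b _.
(* The histories are sorted by the state [s'] that follows the first round. *)
transitivity (\sum_s' \sum_(l : (size w).-tuple (round G))
  \sum_(e | e \in final G) if hist_state (l, e) 0 == s' then f t b l e else 0).
  rewrite [RHS]exchange_big; apply: eq_bigr => l _.
  rewrite [RHS]exchange_big; apply: eq_bigr => e _.
  by rewrite -big_mkcond (big_pred1 (hist_state (l, e) 0)) // => i; rewrite eq_sym.
rewrite mulr_sumr; apply: eq_bigr => s' _.
rewrite play_weight_tuple !mulr_sumr; apply: eq_bigr => l _.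
rewrite !mulr_sumr; apply: eq_bigr => e _.
rewrite /f; case: eqP => [->|_] /=; last by rewrite !mulr0.
by case: eqP => _; rewrite ?mulr0 // !mulrA.
Qed.

Fixpoint strategy_weight (tau : strategy2 G) (l : seq (round G)) : R :=
  if l is (s, a, t, b) :: l' then
    tau [::] s a t b * strategy_weight (fun h => tau ((s, a, t, b) :: h)) l'
  else 1.

Lemma strategy_weightE tau n (l : n.-tuple (round G)) :
  strategy_weight tau l = \prod_(j < n)
   (let: (s, a, t, b) := tnth l j in tau (take j l) s a t b).
Proof.
elim: n tau l => [|n IH] tau l; first by rewrite tuple0 big_ord0.
case/tupleP: l => -[[[s a] t] b] l; rewrite big_ord_recl tnth0 /= IH.
by congr (_ * _); apply: eq_bigr => j _; rewrite tnthS.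
Qed.

Lemma prob_finalE s w tau :
  prob_final s w tau = play_weight (strategy_weight tau) s w.
Proof.
rewrite /prob_final /play_weight; apply: eq_bigr => h _.
rewrite /hist_prob; case: ifP => // _.
rewrite strategy_weightE -big_split /=; apply: eq_bigr => j _.
by case: (tnth _ _) => [[[? ?] ?] ?]; rewrite mulrAC.
Qed.

Lemma play_weightZ c wt s w :
  play_weight (fun l => c * wt l) s w = c * play_weight wt s w.
Proof.
rewrite mulr_sumr; apply: eq_bigr => h _.
by case: ifP; rewrite ?mulr0 // mulrCA.
Qed.

Lemma play_weight_sum (I : finType) (wt : I -> seq (round G) -> R) s w :
  play_weight (fun l => \sum_i wt i l) s w = \sum_i play_weight (wt i) s w.
Proof.
rewrite exchange_big; apply: eq_bigr => h _.
by case: ifP => _; rewrite ?mulr_sumr // big1.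
Qed.

End PlayWeight.

(** * Expectations and binary mixtures of finite distributions *)

Section FiniteDistributions.
Variables (R : realType) (T : finType).

Definition expect (d : fdist R T) (f : T -> R) : R := \sum_x d x * f x.

Lemma expect_le (d : fdist R T) f g :
  (forall x, f x <= g x) -> expect d f <= expect d g.
Proof.
by move=> fg; apply: ler_sum => x _; rewrite ler_wpM2l ?fdist_ge0.
Qed.

Lemma eq_expect (d : fdist R T) f g : f =1 g -> expect d f = expect d g.
Proof. by move=> fg; apply: eq_bigr => x _; rewrite fg. Qed.

Lemma expect_cst (d : fdist R T) c : expect d (fun=> c) = c.
Proof. by rewrite /expect -mulr_suml fdist_sum1 mul1r. Qed.

Lemma expect_linear (d : fdist R T) a f g :
  expect d (fun x => a * f x + g x) = a * expect d f + expect d g.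
Proof.
rewrite /expect mulr_sumr -big_split; apply: eq_bigr => x _ /=.
by rewrite mulrDr mulrCA.
Qed.

Lemma dirac_ge0 (x y : T) : 0 <= (y == x)%:R :> R.
Proof. by []. Qed.

Lemma dirac_sum1 (x : T) : \sum_y (y == x)%:R = 1 :> R.
Proof. by rewrite (bigD1 x) //= eqxx big1 ?addr0 // => y /negbTE ->. Qed.

Definition fdirac (x : T) : fdist R T := FDist (dirac_ge0 x) (dirac_sum1 x).

Lemma expect_dirac x f : expect (fdirac x) f = f x.
Proof.
rewrite /expect (bigD1 x) //= eqxx mul1r big1 ?addr0 // => y /negbTE ->.
by rewrite mul0r.
Qed.

Lemma mixture_ge0 k (d1 d2 : fdist R T) x :
  0 <= k.+1%:R^-1 * d1 x + (1 - k.+1%:R^-1) * d2 x.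
Proof.
rewrite addr_ge0 ?mulr_ge0 ?fdist_ge0 ?invr_ge0 // subr_ge0.
by rewrite invf_le1 ?ler1n.
Qed.

Lemma mixture_sum1 k (d1 d2 : fdist R T) :
  \sum_x (k.+1%:R^-1 * d1 x + (1 - k.+1%:R^-1) * d2 x) = 1.
Proof. by rewrite big_split /= -!mulr_sumr !fdist_sum1 !mulr1 addrC subrK. Qed.

Definition mixture k (d1 d2 : fdist R T) : fdist R T :=
  FDist (mixture_ge0 k d1 d2) (mixture_sum1 k d1 d2).

Lemma expect_mixture k d1 d2 f :
  expect (mixture k d1 d2) f =
  k.+1%:R^-1 * expect d1 f + (1 - k.+1%:R^-1) * expect d2 f.
Proof.
rewrite /expect !mulr_sumr -big_split; apply: eq_bigr => x _ /=.
by rewrite mulrDl !mulrA.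
Qed.

End FiniteDistributions.

(** * The game *)

(* The boolean tells whether a letter b was read since the trial began. *)
Inductive state := Start | Win | Lose | X of bool | Y of bool | Z of bool.

Inductive letter := La | Lb | Zero | One.

Definition state_code (s : state) : option bool * option bool :=
  match s with
  | Start => (None, None) | Win => (None, Some true) | Lose => (None, Some false)
  | X p => (Some true, Some p) | Y p => (Some false, Some p)
  | Z p => (Some p, None)
  end.

Definition state_decode (c : option bool * option bool) : state :=
  match c with
  | (None, None) => Start | (None, Some true) => Win | (None, Some false) => Lose
  | (Some true, Some p) => X p | (Some false, Some p) => Y p
  | (Some p, None) => Z p
  end.

Lemma state_codeK : cancel state_code state_decode.
Proof. by case=> // -[]. Qed.

HB.instance Definition _ := Finite.copy state (can_type state_codeK).

Definition letter_code (x : letter) : bool * bool :=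
  match x with
  | La => (true, true) | Lb => (true, false)
  | Zero => (false, true) | One => (false, false)
  end.

Definition letter_decode (c : bool * bool) : letter :=
  match c with
  | (true, true) => La | (true, false) => Lb
  | (false, true) => Zero | (false, false) => One
  end.

Lemma letter_codeK : cancel letter_code letter_decode.
Proof. by case. Qed.

HB.instance Definition _ := Finite.copy letter (can_type letter_codeK).

Lemma card_letter_gt0 : (0 < #|{: letter}|)%N.
Proof. by apply/card_gt0P; exists La. Qed.

Lemma card_bool_gt0 : (0 < #|{: bool}|)%N.
Proof. by rewrite card_bool. Qed.

Section Game.
Variable R : realType.

Definition split : fdist R state :=
  mixture 1 (fdirac R (Y false))
            (mixture 1 (fdirac R (X false)) (fdirac R (Z false))).

Definition max_move (s : state) (x : letter) : fdist R state :=
  match s, x with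
  | Start, (La | Lb) => fdirac R Start
  | Start, (Zero | One) => split
  | Win, _ => fdirac R Win
  | Lose, _ => fdirac R Lose
  | (X true | Y true | Z true), La => fdirac R Lose
  | X false, La => mixture 3 (fdirac R (X false)) (fdirac R Start)
  | X _, Lb => fdirac R (X true)
  | X _, Zero => fdirac R Win
  | X _, One => fdirac R Lose
  | Y false, La => mixture 1 (fdirac R (Y false)) (fdirac R Start)
  | Y _, Lb => mixture 1 (fdirac R (Y true)) (fdirac R Start)
  | Y _, Zero => fdirac R Lose
  | Y _, One => fdirac R Win
  | Z false, La => fdirac R (Z false)
  | Z _, Lb => mixture 3 (fdirac R (Z true)) (fdirac R Start)
  | Z _, (Zero | One) => fdirac R Lose
  end.

(* The minimizer has a choice only in [X true], where [true] means to stay *)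
(* and [false] means to go back to [Start]. *)
Definition min_target (t : state) (stay : bool) : state :=
  if t is X true then if stay then X true else Start else t.

Definition min_move (t : state) (b : bool) : fdist R state :=
  fdirac R (min_target t b).

Definition game : half_blind_game R :=
  HalfBlindGame card_letter_gt0 card_bool_gt0 max_move min_move [set Win].

Lemma game_weight_nil (wt : seq (round game) -> R) (s : state) :
  play_weight wt (s : S1 game) [::] = (s == Win)%:R * wt [::].
Proof. by rewrite play_weight_nil inE. Qed.

Lemma game_weight_cons (wt : seq (round game) -> R) (s : state) (x : letter) w :
  play_weight wt (s : S1 game) (x :: w) =
  expect (max_move s x) (fun t => \sum_(b : bool)
    play_weight (fun l => wt (((s, x, t, b) : round game) :: l))
      (min_target t b : S1 game) w).
Proof.
rewrite play_weight_cons; apply: eq_bigr => t _; congr (_ * _).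
apply: eq_bigr => b _; exact: (expect_dirac (min_target t b)).
Qed.

Lemma prob_final_cons (tau : strategy2 game) (s : state) (x : letter) w :
  prob_final (s : S1 game) (x :: w) tau =
  expect (max_move s x) (fun t => expect (tau [::] s x t) (fun b =>
    prob_final (min_target t b : S1 game) w
      (fun h => tau (((s, x, t, b) : round game) :: h)))).
Proof.
rewrite prob_finalE game_weight_cons; apply: eq_expect => t.
by apply: eq_bigr => b _; rewrite /= play_weightZ prob_finalE.
Qed.

Lemma prob_final_nil (tau : strategy2 game) (s : state) :
  prob_final (s : S1 game) [::] tau = (s == Win)%:R.
Proof. by rewrite prob_finalE game_weight_nil mulr1. Qed.

(** * The minimizer's counting strategy *)

(* The numbers of letters a and b since the trial began. *)
Definition count_step (c : nat * nat) (x : letter) : nat * nat :=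
  match x with
  | La => (c.1.+1, c.2)
  | Lb => (c.1, c.2.+1)
  | Zero | One => (0%N, 0%N)
  end.

(** Halving from the letter b of index n + 2 on makes the probability of staying on X, as a product
    over the letters b, equal to min(1, 2^(n+1-m)). *)
Definition stay_law (c : nat * nat) : fdist R bool :=
  if (c.2 <= c.1.+1)%N then fdirac R true
  else mixture 1 (fdirac R true) (fdirac R false).

(** The initial counts are a parameter so that the strategy seen after one round is again of this
    form. *)
Definition counting_strategy (c : nat * nat) : strategy2 game :=
  fun h s x t =>
    stay_law (count_step (foldl count_step c [seq r.1.1.2 | r : round game <- h]) x).

Definition counting_prob c (s : state) (w : seq letter) : R :=
  prob_final (s : S1 game) w (counting_strategy c).

Lemma counting_prob_nil c s : counting_prob c s [::] = (s == Win)%:R.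
Proof. exact: prob_final_nil. Qed.

Lemma counting_prob_cons c s x w :
  counting_prob c s (x :: w) =
  expect (max_move s x) (fun t =>
    if t is X true then expect (stay_law (count_step c x)) (fun b =>
      counting_prob (count_step c x) (if b then X true else Start) w)
    else counting_prob (count_step c x) t w).
Proof.
rewrite /counting_prob prob_final_cons; apply: eq_expect => t.
transitivity (expect (stay_law (count_step c x)) (fun b =>
    counting_prob (count_step c x) (min_target t b) w)); first by [].
by case: t => [|||[]||] * //=; exact: expect_cst.
Qed.

Lemma counting_prob_Win c w : counting_prob c Win w = 1.
Proof.
elim: w c => [|x w IH] c; first by rewrite counting_prob_nil eqxx.
by rewrite counting_prob_cons expect_dirac.
Qed.

Lemma counting_prob_Lose c w : counting_prob c Lose w = 0.
Proof.
elim: w c => [|x w IH] c; first by rewrite counting_prob_nil.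
by rewrite counting_prob_cons expect_dirac.
Qed.

Definition halves (n : nat) : R := 2^-1 ^+ n.

Lemma halves_gt0 n : 0 < halves n.
Proof. by rewrite exprn_gt0 // invr_gt0. Qed.

Lemma halves_le1 n : halves n <= 1.
Proof. by rewrite exprn_ile1 // ?invr_ge0 // invf_le1 ?ler1n. Qed.

Lemma halvesS n : halves n.+1 = halves n / 2.
Proof. by rewrite /halves exprSr. Qed.

Lemma halves_mono m n : (m <= n)%N -> halves n <= halves m.
Proof.
by move=> mn; apply: ler_wiXn2l; rewrite ?invr_ge0 // invf_le1 ?ler1n.
Qed.

(* Four times the probability of the line X after the letters a^n b^m, the *)
(* lines Y and Z having probabilities 2^-(n+m) / 2 and 4^-m / 4. *)
Definition x_weight n m : R :=
  if (m <= n.+1)%N then halves n ^+ 2 else 2 * halves n * halves m.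

Lemma x_weight_le n m : x_weight n m <= 2 * halves n * halves m.
Proof.
rewrite /x_weight; case: ifP => // /halves_mono; rewrite halvesS => mn.
by have := halves_gt0 n; nra.
Qed.

(** This is A^2 + B^2 >= 2AB before the bend, and trivial after it. *)
Lemma x_weight_ge n m :
  2 * halves n * halves m <= x_weight n m + halves m ^+ 2.
Proof.
rewrite /x_weight; case: ifP => _; last by have := halves_gt0 m; nra.
by have := sqr_ge0 (halves n - halves m); nra.
Qed.

Lemma x_weight_ge0 n m : 0 <= x_weight n m.
Proof.
have := halves_gt0 n; have := halves_gt0 m.
by rewrite /x_weight; case: ifP => _; nra.
Qed.

Lemma x_weight_le1 n m : x_weight n m <= 1.
Proof.
rewrite /x_weight; case: ifPn => [_|].
  by rewrite exprn_ile1 ?halves_le1 // ltW ?halves_gt0.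
rewrite -ltnNge => /ltnW/halves_mono; rewrite halvesS.
have := halves_le1 n; have := halves_gt0 n; have := halves_gt0 m; nra.
Qed.

(** Winning probability of [w] from the law of the token after a^n b^m; no mass is lost within such
    a word, so what has left the lines is at [Start]. *)
Definition trial_prob n m (w : seq letter) : R :=
  let U s := counting_prob (n, m) s w in
  let x := x_weight n m / 4 in
  let y := halves n * halves m / 2 in
  let z := halves m ^+ 2 / 4 in
  let p := (0 < m)%N in
  x * U (X p) + y * U (Y p) + z * U (Z p) + (1 - x - y - z) * U Start.

Lemma stay_x_weight n m (f : bool -> R) :
  x_weight n m * expect (stay_law (n, m.+1)) f =
  x_weight n m.+1 * f true + (x_weight n m - x_weight n m.+1) * f false.
Proof.
rewrite /stay_law /x_weight /= ltnS; case: (leqP m n) => mn.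
  by rewrite leqW // expect_dirac subrr mul0r addr0.
rewrite expect_mixture !expect_dirac halvesS.
case: ifPn => [mn'|_]; last by field.
(* At m = n + 1 the two formulas of [x_weight] agree. *)
have -> : m = n.+1 by apply/eqP; rewrite eqn_leq mn mn'.
by rewrite halvesS; field.
Qed.

(** The two bounds need each other: a letter that ends a trial sends the mass at [Start] into a new
    one, and a trial returns mass to [Start]. [Start] is bounded for all counts, because letters
    read while waiting there are counted too. *)
Lemma counting_prob_le w :
  (forall c, counting_prob c Start w <= 2^-1) /\
  (forall n m, trial_prob n m w <= 2^-1).
Proof.
elim: w => [|x w [IHS IHR]].
  split=> [c|n m]; rewrite /trial_prob ?counting_prob_nil /=; first by rewrite invr_ge0.
  by rewrite !mulr0 !addr0 invr_ge0.
have rp00 : trial_prob 0 0 w = 2^-1 * counting_prob (0, 0)%N (Y false) w +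
    (4^-1 * counting_prob (0, 0)%N (X false) w +
     4^-1 * counting_prob (0, 0)%N (Z false) w).
  by rewrite /trial_prob /x_weight /halves /= !expr0; field.
have StartE c : counting_prob c Start (x :: w) =
    if x is (La | Lb) then counting_prob (count_step c x) Start w
    else trial_prob 0 0 w.
  rewrite counting_prob_cons rp00.
  by case: x; rewrite /= ?expect_dirac // /split !expect_mixture !expect_dirac; field.
have StartLe c : counting_prob c Start (x :: w) <= 2^-1.
  by rewrite StartE; case: x {StartE}.
split=> // n m; rewrite /trial_prob StartE !counting_prob_cons.
have hn0 := halves_gt0 n; have hm0 := halves_gt0 m.
have hn1 := halves_le1 n; have hm1 := halves_le1 m.
have xle := x_weight_le n m; have xge := x_weight_ge n m.
have x0 := x_weight_ge0 n m; have x1 := x_weight_le1 n m.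
have yz : 0 <= halves n * halves m <= 1 by rewrite mulr_ge0 ?mulr_ile1 //= ltW.
have z1 : 0 <= halves m ^+ 2 <= 1 by rewrite sqr_ge0 exprn_ile1 // ltW.
have s0 : 0 <= 1 - x_weight n m / 4 - halves n * halves m / 2 - halves m ^+ 2 / 4.
  by lra.
case: x StartE StartLe => StartE StartLe.
(* A letter a after some b loses every line, and only the mass at [Start] can still win. *)
- have [->|m0] := posnP m.
    have := IHR n.+1 0%N.
    rewrite !expect_mixture !expect_dirac /trial_prob /x_weight /= !halvesS.
    rewrite /halves expr0. lra.
  rewrite /= !expect_dirac !counting_prob_Lose.
  have := IHS (n.+1, m); rewrite -subr_ge0 => /(mulr_ge0 s0).
  lra.
- have := IHR n m.+1; rewrite /trial_prob /=.
  rewrite !if_same !expect_mixture !expect_dirac.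
  have := stay_x_weight n m (fun b =>
    counting_prob (n, m.+1) (if b then X true else Start) w).
  rewrite halvesS /=. lra.
(* [Zero]: the mass won on X is at most the mass lost on Y, by [x_weight_le]. *)
- have := IHR 0%N 0%N; rewrite -subr_ge0 => /(mulr_ge0 s0).
  rewrite /= !if_same !expect_dirac !counting_prob_Win !counting_prob_Lose.
  lra.
(* [One]: the mass won on Y is at most the mass lost on X and Z, by [x_weight_ge]. *)
- have := IHR 0%N 0%N; rewrite -subr_ge0 => /(mulr_ge0 s0).
  rewrite /= !if_same !expect_dirac !counting_prob_Win !counting_prob_Lose.
  lra.
Qed.

End Game.

(** * Finite-memory strategies *)

Lemma exp_vanishing (R : realType) (q e : R) :
  0 <= q < 1 -> 0 < e -> exists N, q ^+ N <= e.
Proof.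
move=> /andP[q0 q1] e0.
have /cvgrPdist_le /(_ e e0) [N _ /(_ N (leqnn N))] :=
  @cvg_expr R q (eq_ind_r (fun x => x < 1) q1 (ger0_norm q0)).
by rewrite /= sub0r normrN ger0_norm ?exprn_ge0 // => qN; exists N.
Qed.

(** Each sequence is bounded away from 0, and then a lower bound serves as factor, or falls below
    [e], and then the left side is nonpositive. The factor [rho] is chosen before [e], and
    finiteness of [I] makes it uniform. *)
Lemma nonincreasing_dominance (R : realType) (I : finType) (H : nat -> I -> R) :
  (forall k i, 0 <= H k i <= 1) -> (forall k i, H k.+1 i <= H k i) ->
  exists2 rho : R, 0 < rho <= 1 &
    forall e, 0 < e -> exists k0, forall k k' i, (k0 <= k)%N ->
      rho * (H k i - e) <= H k' i.
Proof.
move=> H01 Hdec.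
have Hmono i k k' : (k <= k')%N -> H k' i <= H k i.
  elim: k' => [|k' IH]; first by rewrite leqn0 => /eqP ->.
  rewrite leq_eqVlt ltnS => /predU1P[->//|/IH]; exact: le_trans.
have /choice[r rP] : forall i, exists r : R, 0 < r <= 1 /\
    forall e, 0 < e -> exists k0, forall k k', (k0 <= k)%N ->
      r * (H k i - e) <= H k' i.
  move=> i; have [[r r0 rH]|noinf] := pselect (exists2 r, 0 < r & forall k, r <= H k i).
    exists (Num.min r 1); split; first by rewrite lt_min r0 ltr01 ge_min lexx orbT.
    move=> e e0; exists 0%N => k k' _; apply: le_trans (rH k').
    have /andP[Hk0 Hk1] := H01 k i.
    have m0 : 0 <= Num.min r 1 by rewrite le_min ltW // ler01.
    apply: (@le_trans _ _ (Num.min r 1)); last by rewrite ge_min lexx.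
    by rewrite ler_piMr //; lra.
  exists 1; split; first by rewrite ltr01 lexx.
  move=> e e0; have [k0 Hk0] : exists k0, H k0 i < e.
    apply: contrapT => noe; apply: noinf; exists e => // k.
    by rewrite leNgt; apply/negP => ?; apply: noe; exists k.
  exists k0 => k k' k0k; rewrite mul1r.
  have := Hmono i _ _ k0k; have /andP[] := H01 k' i; lra.
(* A product of factors in (0, 1] is below each of them. *)
pose rho := \prod_i r i.
have rho0 : 0 < rho by apply: prodr_gt0 => i _; have [/andP[]] := rP i.
have rhole i : rho <= r i.
  rewrite /rho (bigD1 i) //= ler_piMr //; first by have [/andP[/ltW]] := rP i.
  by apply: prodr_ile1 => j _; have [/andP[/ltW-> ->]] := rP j.
exists rho; first by rewrite rho0 prodr_ile1 // => i _; have [/andP[/ltW-> ->]] := rP i.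
move=> e e0; have /choice[k0 k0P] : forall i, exists k0, forall k k', (k0 <= k)%N ->
      r i * (H k i - e) <= H k' i by move=> i; have [_ /(_ e e0)] := rP i.
exists (\max_i k0 i)%N => k k' i lek.
have [neg|pos] := leP (H k i - e) 0.
  apply: (@le_trans _ _ 0); last by have /andP[] := H01 k' i.
  by rewrite mulr_ge0_le0 // ltW.
apply: le_trans (k0P i k k' _); first by rewrite ler_wpM2r // ltW.
by apply: leq_trans lek; exact: leq_bigmax.
Qed.

(** * One round against a transducer, as an operator on test functions *)

Section FiniteMemory.
Variables (R : realType) (T : transducer (game R)).
Let M := memory T.
Let test := M -> state -> R.

Definition reply (m : M) (s : state) (x : letter) (t : state)
    (f : bool -> M -> R) : R :=
  expect (update (SymS1 (s : S1 (game R))) m) (fun m1 =>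
  expect (update (SymA1 (x : A1 (game R))) m1) (fun m2 =>
  expect (update (SymS2 (t : S2 (game R))) m2) (fun m3 =>
  expect (output m3) (fun b =>
  expect (update (SymA2 (b : A2 (game R))) m3) (f b))))).

Lemma reply_le m s x t f g :
  (forall b m, f b m <= g b m) -> reply m s x t f <= reply m s x t g.
Proof. by move=> fg; do 5!apply: expect_le => ?; exact: fg. Qed.

Lemma reply_cst m s x t c : reply m s x t (fun _ _ => c) = c.
Proof.
rewrite /reply -[RHS](expect_cst (update (SymS1 (s : S1 (game R))) m)).
apply: eq_expect => m1; rewrite -[RHS](expect_cst (update (SymA1 (x : A1 (game R))) m1)).
apply: eq_expect => m2; rewrite -[RHS](expect_cst (update (SymS2 (t : S2 (game R))) m2)).
apply: eq_expect => m3; rewrite -[RHS](expect_cst (output m3)).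
by apply: eq_expect => b; rewrite expect_cst.
Qed.

Lemma reply_linear m s x t a f g :
  reply m s x t (fun b m => a * f b m + g b m) =
  a * reply m s x t f + reply m s x t g.
Proof.
rewrite /reply -expect_linear; apply: eq_expect => m1.
rewrite -expect_linear; apply: eq_expect => m2.
rewrite -expect_linear; apply: eq_expect => m3.
rewrite -expect_linear; apply: eq_expect => b.
by rewrite -expect_linear.
Qed.

(** Backward operator of the Markov chain on (memory state, game state) driven by [x]; [push] below
    is its dual and moves measures forward. *)
Definition step_op (x : letter) (f : test) : test := fun m s =>
  expect (max_move R s x) (fun t => reply m s x t (fun b m' => f m' (min_target t b))).

Lemma step_op_le x f g : (forall m s, f m s <= g m s) ->
  forall m s, step_op x f m s <= step_op x g m s.
Proof. by move=> fg m s; apply: expect_le => t; apply: reply_le. Qed.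

Lemma step_op_linear x a f g m s :
  step_op x (fun m s => a * f m s + g m s) m s =
  a * step_op x f m s + step_op x g m s.
Proof.
rewrite /step_op -expect_linear; apply: eq_expect => t.
by rewrite -reply_linear.
Qed.

Lemma step_op_state x (phi : state -> R) m s :
  step_op x (fun=> phi) m s =
  expect (max_move R s x) (fun t => if t is X true then
    reply m s x t (fun b _ => phi (if b then X true else Start)) else phi t).
Proof.
apply: eq_expect => t.
by case: t => [|||[]||] * //=; exact: reply_cst.
Qed.

Definition fm_prob (w : seq letter) : test := fun m s =>
  play_weight (output_prob m) (s : S1 (game R)) w.

Lemma fm_prob_nil m s : fm_prob [::] m s = (s == Win)%:R.
Proof. by rewrite /fm_prob game_weight_nil mulr1. Qed.

Lemma fm_prob_cons x w : fm_prob (x :: w) = step_op x (fm_prob w).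
Proof.
apply/funext => m; apply/funext => s; rewrite /fm_prob game_weight_cons.
apply: eq_expect => t; rewrite /reply /expect.
under eq_bigr => b _.
  rewrite /= play_weight_sum.
  under eq_bigr => m1 _.
    rewrite play_weightZ play_weight_sum.
    under eq_bigr => m2 _.
      rewrite play_weightZ play_weight_sum.
      under eq_bigr => m3 _.
        rewrite play_weightZ play_weight_sum.
        under eq_bigr => m4 _ do rewrite play_weightZ.
        over.
      over.
    over.
  over.
rewrite exchange_big; apply: eq_bigr => m1 _; rewrite -mulr_sumr; congr (_ * _).
rewrite exchange_big; apply: eq_bigr => m2 _; rewrite -mulr_sumr; congr (_ * _).
rewrite exchange_big; apply: eq_bigr => m3 _; rewrite mulr_sumr.
by apply: eq_bigr => b _; rewrite mulrA.
Qed.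

Lemma fm_prob_bound w m s : 0 <= fm_prob w m s <= 1.
Proof.
elim: w m s => [|x w IH] m s.
  by rewrite fm_prob_nil; case: eqP; rewrite ?lexx ?ler01.
have cst c : step_op x (fun _ _ => c) m s = c.
  rewrite /step_op -[RHS](expect_cst (max_move R s x)).
  by apply: eq_expect => t; exact: reply_cst.
rewrite fm_prob_cons; apply/andP; split; [rewrite -(cst 0) | rewrite -[leRHS](cst 1)];
  by apply: step_op_le => m' s'; have /andP[] := IH m' s'.
Qed.

(** * Measures on configurations and the masses of the lines *)

(* A measure on the configurations (memory state, game state) is represented *)
(* by its integral, a positive linear functional on test functions. *)
Definition pos_linear (L : test -> R) : Prop :=
  (forall a f g, L (fun m s => a * f m s + g m s) = a * L f + L g) /\
  (forall f g, (forall m s, f m s <= g m s) -> L f <= L g).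

Definition push (L : test -> R) (x : letter) : test -> R := fun f => L (step_op x f).

Lemma pos_linear_push L x : pos_linear L -> pos_linear (push L x).
Proof.
move=> [lin mono]; split=> [a f g|f g fg]; last exact/mono/step_op_le.
rewrite /push -lin; congr L; apply/funext => m; apply/funext => s.
exact: step_op_linear.
Qed.

Lemma pos_linear_comb L (l : seq (R * test)) f : pos_linear L ->
  (forall m s, f m s = \sum_(p <- l) p.1 * p.2 m s) ->
  L f = \sum_(p <- l) p.1 * L p.2.
Proof.
move=> [lin _] fE; have {fE} -> : f = fun m s => \sum_(p <- l) p.1 * p.2 m s.
  by apply/funext => m; apply/funext => s.
elim: l => [|p l IH].
  (* For z = 0, linearity gives L z = L z + L z. *)
  rewrite big_nil; set z : test := fun _ => _; have := lin 1 z z.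
  have -> : (fun m s => 1 * z m s + z m s) = z.
    by apply/funext => m; apply/funext => s; rewrite /z big_nil mulr0 addr0.
  lra.
rewrite big_cons -IH -lin; congr L; apply/funext => m; apply/funext => s.
by rewrite big_cons.
Qed.

Definition ind (s' : state) : test := fun _ s => (s == s')%:R.

Definition unresolved : test := fun _ s => ((s != Win) && (s != Lose))%:R.

(** The minimizer chooses only in [X true], which is entered only by [Lb]; otherwise, or if [phi]
    does not see the choice, the memory is irrelevant. *)
Lemma step_op_expect x (phi : state -> R) m s :
  x <> Lb \/ phi (X true) = phi Start ->
  step_op x (fun=> phi) m s = expect (max_move R s x) phi.
Proof.
move=> [xb|phiE]; rewrite step_op_state; last first.
  apply: eq_expect => -[|||[]|b|b] //.
  rewrite -[RHS](reply_cst m s x (X true)); congr reply.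
  by apply/funext => -[]; apply/funext => _.
case: x xb => [|/(_ erefl)//||] _; case: s => [|||[]|[]|[]];
  by rewrite /= /split ?expect_mixture ?expect_dirac.
Qed.

Record masses (L : test -> R) (win u xf xt yf yt zf zt : R) : Prop := Masses {
  mass_Win : L (ind Win) = win;
  mass_unresolved : L unresolved = u;
  mass_Xf : L (ind (X false)) = xf;
  mass_Xt : L (ind (X true)) = xt;
  mass_Yf : L (ind (Y false)) = yf;
  mass_Yt : L (ind (Y true)) = yt;
  mass_Zf : L (ind (Z false)) = zf;
  mass_Zt : L (ind (Z true)) = zt }.

(** Expresses the pulled-back test function as the linear combination [l] of recorded ones, checked
    state by state. *)
Ltac mass_comb l := rewrite /push (@pos_linear_comb _ l) //;
  [ rewrite ?big_cons ?big_nil /=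
  | move=> ? [|||[]|[]|[]]; rewrite ?big_cons ?big_nil /ind /unresolved;
    (rewrite step_op_expect; [|by (right + left)]);
    rewrite ?big_cons ?big_nil /= /split ?expect_mixture ?expect_dirac
      /ind /unresolved ?eqE /=; lra].

Lemma masses_La L win u xf xt yf yt zf zt :
  pos_linear L -> masses L win u xf xt yf yt zf zt ->
  masses (push L La) win (u - xt - yt - zt) (xf / 4) 0 (yf / 2) 0 zf 0.
Proof.
move=> Llin [<- <- <- <- <- <- <- <-]; split.
- mass_comb [:: (1 : R, ind Win)]; lra.
- mass_comb [:: (1 : R, unresolved); (-1 : R, ind (X true));
    (-1 : R, ind (Y true)); (-1 : R, ind (Z true))]; lra.
- mass_comb [:: (1/4 : R, ind (X false))]; lra.
- mass_comb (Nil (R * test)); lra.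
- mass_comb [:: (1/2 : R, ind (Y false))]; lra.
- mass_comb (Nil (R * test)); lra.
- mass_comb [:: (1 : R, ind (Z false))]; lra.
- mass_comb (Nil (R * test)); lra.
Qed.

(** The mass of [X true] is left as a functional, being the only one that depends on the memory. *)
Lemma masses_Lb L win u xf xt yf yt zf zt :
  pos_linear L -> masses L win u xf xt yf yt zf zt ->
  masses (push L Lb) win u 0 (L (step_op Lb (ind (X true))))
    0 ((yf + yt) / 2) 0 ((zf + zt) / 4).
Proof.
move=> Llin [<- <- _ _ <- <- <- <-]; split.
- mass_comb [:: (1 : R, ind Win)]; lra.
- mass_comb [:: (1 : R, unresolved)]; lra.
- mass_comb (Nil (R * test)); lra.
- by [].
- mass_comb (Nil (R * test)); lra.
- mass_comb [:: (1/2 : R, ind (Y false)); (1/2 : R, ind (Y true))]; lra.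
- mass_comb (Nil (R * test)); lra.
- mass_comb [:: (1/4 : R, ind (Z false)); (1/4 : R, ind (Z true))]; lra.
Qed.

Lemma masses_end L x win u xf xt yf yt zf zt (st := u - xf - xt - yf - yt - zf - zt) :
  pos_linear L -> masses L win u xf xt yf yt zf zt -> x = Zero \/ x = One ->
  masses (push L x) (win + (if x is Zero then xf + xt else yf + yt))
    st (st / 4) 0 (st / 2) 0 (st / 4) 0.
Proof.
move=> Llin; rewrite /st {st} => -[<- <- <- <- <- <- <- <-].
pose start (c : R) : seq (R * test) :=
  [:: (c, unresolved); (- c, ind (X false)); (- c, ind (X true));
  (- c, ind (Y false)); (- c, ind (Y true)); (- c, ind (Z false)); (- c, ind (Z true))].
case=> ->; split.
- mass_comb [:: (1 : R, ind Win); (1 : R, ind (X false)); (1 : R, ind (X true))]; lra.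
- mass_comb (start 1); lra.
- mass_comb (start (1/4)); lra.
- mass_comb (Nil (R * test)); lra.
- mass_comb (start (1/2)); lra.
- mass_comb (Nil (R * test)); lra.
- mass_comb (start (1/4)); lra.
- mass_comb (Nil (R * test)); lra.
- mass_comb [:: (1 : R, ind Win); (1 : R, ind (Y false)); (1 : R, ind (Y true))]; lra.
- mass_comb (start 1); lra.
- mass_comb (start (1/4)); lra.
- mass_comb (Nil (R * test)); lra.
- mass_comb (start (1/2)); lra.
- mass_comb (Nil (R * test)); lra.
- mass_comb (start (1/4)); lra.
- mass_comb (Nil (R * test)); lra.
Qed.

Lemma pos_linear_ge0 L f : pos_linear L -> (forall m s, 0 <= f m s) -> 0 <= L f.
Proof.
move=> Llin f0; have <- : L (fun _ _ => 0) = 0.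
  by rewrite (@pos_linear_comb _ [::]) ?big_nil // => m s; rewrite big_nil.
exact: Llin.2.
Qed.

(** * Survival on the line X *)

(* Starting from X, the probability of being still in X after k + 1 letters b. *)
Definition survival (k : nat) : test :=
  iter k (step_op Lb) (step_op Lb (ind (X true))).

Let in_X : test := fun m s => ind (X false) m s + ind (X true) m s.

Lemma survival0_le m s : survival 0 m s <= in_X m s.
Proof.
have le1 b : reply m (X b) Lb (X true) (fun c _ =>
    ((if c then X true else Start) == X true)%:R) <= 1 :> R.
  rewrite -[leRHS](reply_cst m (X b) Lb (X true)); apply: reply_le => c _.
  by case: (_ == _).
rewrite /survival /= /ind step_op_state.
by case: s => [|||[]|[]|[]]; rewrite /= ?expect_mixture !expect_dirac /in_X /ind !eqE /=;
  rewrite ?mulr0 ?addr0 ?add0r.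
Qed.

Lemma survival_dec k m s : survival k.+1 m s <= survival k m s.
Proof.
elim: k m s => [|k IH] m s; last exact: step_op_le.
(* After a letter b the token is never in [X false], so [in_X] and the indicator of [X true] have
   the same image under [step_op Lb]. *)
apply: le_trans (@step_op_le Lb _ _ survival0_le m s) _.
rewrite /survival /= /in_X /ind !step_op_state.
rewrite le_eqVlt; apply/orP; left; apply/eqP.
case: s => [|||[]|[]|[]];
  rewrite /= ?expect_mixture ?expect_dirac ?eqE /= ?addr0 ?mulr0 ?addr0 //;
  by congr reply; apply/funext => -[]; apply/funext => _; rewrite ?eqE /= ?addr0 ?add0r.
Qed.

Lemma survival_ge0 k m s : 0 <= survival k m s.
Proof.
rewrite /survival -iterSr; elim: k.+1 m s => [|{}k IH] m s; first exact: ler0n.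
have := @step_op_le Lb _ _ IH m s.
by rewrite step_op_expect ?expect_cst //; right.
Qed.

Lemma survival_le_in_X k m s : survival k m s <= in_X m s.
Proof.
elim: k => [|k]; first exact: survival0_le.
exact: le_trans (survival_dec k m s).
Qed.

(** Dominance integrated against [L]. The bound [k0] does not depend on [L], so it may be fixed
    before the word a^n that produces [L]; the error is charged to X alone, hence scales like the
    mass 4^-n left there. *)
Lemma survival_dominance : exists2 rho : R, 0 < rho <= 1 &
  forall e, 0 < e -> exists k0, forall L k k', pos_linear L -> (k0 <= k)%N ->
    L (ind (X true)) = 0 ->
    rho * (L (survival k) - e * L (ind (X false))) <= L (survival k').
Proof.
have [||rho rho01 rhoP] := @nonincreasing_dominance R (M * state)%type
  (fun k z => survival k z.1 z.2).
- move=> k [m s]; rewrite survival_ge0 (le_trans (survival_le_in_X _ _ _)) //=.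
  by rewrite /in_X /ind; case: s => [|||[]|[]|[]]; rewrite !eqE /= ?addr0 ?add0r.
- by move=> k [m s]; exact: survival_dec.
exists rho => // e e0; have [k0 k0P] := rhoP e e0.
exists k0 => L k k' Llin k0k Xt0.
have -> : rho * (L (survival k) - e * L (ind (X false))) =
    L (fun m s => rho * (survival k m s - e * in_X m s)).
  rewrite [RHS](@pos_linear_comb L [:: (rho, survival k); (- (rho * e), ind (X false));
    (- (rho * e), ind (X true))]) // ?big_cons ?big_nil /= ?Xt0; first by ring.
  by move=> m s; rewrite ?big_cons ?big_nil /in_X /=; ring.
apply: Llin.2 => m s; have /andP[rho0 _] := rho01.
have [|] := boolP ((s == X false) || (s == X true)) => sX.
  have -> : in_X m s = 1.
    by rewrite /in_X /ind; case/orP: sX => /eqP ->; rewrite !eqE /= ?addr0 ?add0r.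
  by rewrite mulr1; exact: (k0P k k' (m, s)).
have X0 : in_X m s = 0.
  by rewrite /in_X /ind; case/norP: sX => /negbTE -> /negbTE ->; rewrite addr0.
have -> : survival k m s = 0.
  by apply/eqP; rewrite eq_le survival_ge0 -X0 survival_le_in_X.
by rewrite X0 mulr0 subrr mulr0 survival_ge0.
Qed.

Definition pushes (L : test -> R) (w : seq letter) : test -> R := foldl push L w.

Lemma pos_linear_pushes L w : pos_linear L -> pos_linear (pushes L w).
Proof. by elim: w L => //= x w IH L Llin; apply/IH/pos_linear_push. Qed.

(** Duality: integrating the backward value equals pushing the measure forward and reading off the
    mass of [Win]. *)
Lemma fm_prob_pushes (L : test -> R) w : L (fm_prob w) = pushes L w (ind Win).
Proof.
elim: w L => [|x w IH] L /=.
  by congr L; apply/funext => m; apply/funext => s; rewrite fm_prob_nil.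
by rewrite fm_prob_cons -IH.
Qed.

Lemma masses_nseq_La L win u x y z n :
  pos_linear L -> masses L win u x 0 y 0 z 0 ->
  masses (pushes L (nseq n La)) win u (x * halves R n ^+ 2) 0 (y * halves R n) 0 z 0.
Proof.
elim: n L x y => [|n IH] L x y Llin LM /=.
  by rewrite /halves expr0 expr1n !mulr1.
have := masses_La Llin LM; rewrite !subr0 => /(IH _ _ _ (pos_linear_push La Llin)).
rewrite halvesS.
have -> : x / 4 * halves R n ^+ 2 = x * (halves R n / 2) ^+ 2 by field.
by have -> : y / 2 * halves R n = y * (halves R n / 2) by field.
Qed.

Lemma pushes_nseq_Lb (L : test -> R) k f : pushes L (nseq k Lb) f = L (iter k (step_op Lb) f).
Proof. by elim: k L => //= k IH L; rewrite IH. Qed.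

Lemma masses_nseq_Lb L win u x y z k :
  pos_linear L -> masses L win u x 0 y 0 z 0 ->
  masses (pushes L (nseq k.+1 Lb)) win u 0 (L (survival k)) 0 (y * halves R k.+1)
    0 (z * halves R k.+1 ^+ 2).
Proof.
move=> Llin LM.
(* The mass of [X true] need not be tracked in the induction: it is read off at the end as
   [L (survival k)]. *)
suff [xt] : exists xt, masses (pushes L (nseq k.+1 Lb)) win u 0 xt 0 (y * halves R k.+1)
    0 (z * halves R k.+1 ^+ 2).
  move=> H; suff -> : L (survival k) = xt by [].
  by rewrite -(mass_Xt H) pushes_nseq_Lb /survival -iterSr.
elim: k => [|k [xt IH]].
  exists (L (step_op Lb (ind (X true)))).
  have := masses_Lb Llin LM; rewrite !addr0 /pushes /= /halves.
  have -> : y / 2 = y * 2^-1 ^+ 1 by field.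
  by have -> : z / 4 = z * (2^-1 ^+ 1) ^+ 2 by field.
exists (pushes L (nseq k.+1 Lb) (step_op Lb (ind (X true)))).
have := masses_Lb (pos_linear_pushes _ Llin) IH.
rewrite !add0r halvesS [halves R k.+2]halvesS.
have -> : y * (halves R k / 2) / 2 = y * (halves R k.+1 / 2) by rewrite halvesS; field.
have -> : z * (halves R k / 2) ^+ 2 / 4 = z * (halves R k.+1 / 2) ^+ 2.
  by rewrite halvesS; field.
by rewrite /pushes -[nseq k.+2 Lb]/(nseq (1 + k.+1) Lb) addnC nseqD foldl_cat.
Qed.

Lemma halvesD n k : halves R (n + k) = halves R n * halves R k.
Proof. exact: exprD. Qed.

Lemma halves_small (e : R) : 0 < e -> exists k, halves R k <= e.
Proof. by move=> e0; apply: exp_vanishing => //; lra. Qed.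

(** * Profitable trials and their repetition *)

Definition trial_start (L : test -> R) (win c : R) : Prop :=
  pos_linear L /\ masses L win c (c / 4) 0 (c / 2) 0 (c / 4) 0.

Lemma trial_start_ge0 L win c : trial_start L win c -> 0 <= c.
Proof.
by move=> [Llin LM]; rewrite -(mass_unresolved LM); apply: pos_linear_ge0.
Qed.

Lemma trial_startP L win c n k x : trial_start L win c -> x = Zero \/ x = One ->
  let S := pushes L (nseq n La) (survival k) in
  let Y := c / 2 * halves R n * halves R k.+1 in
  let Z := c / 4 * halves R k.+1 ^+ 2 in
  trial_start (pushes L (nseq n La ++ nseq k.+1 Lb ++ [:: x]))
    (win + (if x is Zero then S else Y)) (c - S - Y - Z).
Proof.
move=> [Llin LM] xE S Y Z.
have lina := pos_linear_pushes (nseq n La) Llin.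
have Mb := masses_nseq_Lb k lina (masses_nseq_La n Llin LM).
have linb := pos_linear_pushes (nseq k.+1 Lb) lina.
have := masses_end linb Mb xE; rewrite !subr0 !add0r.
have -> : pushes L (nseq n La ++ nseq k.+1 Lb ++ [:: x]) =
  push (pushes (pushes L (nseq n La)) (nseq k.+1 Lb)) x by rewrite /pushes !foldl_cat.
by split=> //; exact: pos_linear_push.
Qed.

(** Here [a] is the mass won, and the last inequality says that the mass lost, c - c' - a, is at
    most d a. [kappa] is uniform in [L], so the gain can be repeated. *)
Lemma trial_gain k (d := halves R k.+1) : exists2 kappa : R, 0 < kappa <= 1 &
  forall L win c, trial_start L win c -> exists w a c',
    [/\ trial_start (pushes L w) (win + a) c', kappa * c <= a
      & c - (1 + d) * a <= c'].
Proof.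
have d0 : 0 < d := halves_gt0 R k.+1; have d1 : d <= 1 := halves_le1 R k.+1.
have [rho /andP[rho0 rho1] rhoP] := survival_dominance.
have dd0 : 0 < d ^+ 2 / 2 by rewrite divr_gt0 // exprn_gt0.
(* With error d^2 / 2, a mass on X above the threshold c A^2 d^2 / 4 leaves at least rho c A^2 d^2 /
   8 there forever; [n] is the rank from which dominance holds. *)
have [n nP] := rhoP _ dd0; set A := halves R n.
have A0 : 0 < A := halves_gt0 R n; have A1 : A <= 1 := halves_le1 R n.
have rdd0 : 0 < rho * d ^+ 3 / 8 by rewrite divr_gt0 // mulr_gt0 // exprn_gt0.
have [k2 k2P] := halves_small rdd0.
have AA : 0 < A ^+ 2 <= 1 by rewrite exprn_gt0 //= exprn_ile1 // ltW.
have dd : 0 < d ^+ 2 <= 1 by rewrite exprn_gt0 //= exprn_ile1 // ltW.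
exists (rho * A ^+ 2 * d ^+ 2 / 8).
  have p0 : 0 < rho * A ^+ 2 * d ^+ 2 by rewrite !mulr_gt0 //; lra.
  have p1 : rho * A ^+ 2 * d ^+ 2 <= 1.
    by rewrite !mulr_ile1 // ?mulr_ge0 //; lra.
  lra.
move=> L win c Ls; have c0 := trial_start_ge0 Ls.
have [Llin LM] := Ls.
have Ma := masses_nseq_La n Llin LM; have lina := pos_linear_pushes (nseq n La) Llin.
have := nP _ (n + k)%N (n + k2)%N lina (leq_addr _ _) (mass_Xt Ma).
rewrite (mass_Xf Ma) -/A.
set S1 := pushes _ _ (survival (n + k)); set S2 := pushes _ _ _ => S12.
have Q0 : 0 <= c * A ^+ 2 by rewrite mulr_ge0 //; lra.
have [small|big] := leP S1 (c / 4 * A ^+ 2 * d ^+ 2).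
  (* With m = n + k + 1, Y wins c A^2 d / 2, while X and Z lose at most c A^2 d^2 / 4 each: exactly
     d times the gain. *)
  exists (nseq n La ++ nseq (n + k).+1 Lb ++ [:: One]).
  eexists; eexists; split; first exact: (trial_startP n (n + k) Ls (or_intror erefl)).
    rewrite -addnS halvesD -/d -/A.
    have -> : rho * A ^+ 2 * d ^+ 2 / 8 * c = (c * A ^+ 2) * (rho * d * (d / 8)).
      by field.
    have -> : c / 2 * A * (A * d) = (c * A ^+ 2) * (d / 2) by field.
    apply: ler_wpM2l => //.
    have : rho * d <= 1 by rewrite mulr_ile1 // ltW.
    by have : 0 <= rho * d; [rewrite mulr_ge0 // ltW|nra].
  rewrite -/S1 -addnS halvesD -/d -/A; nra.
(* X keeps S2 >= rho c A^2 d^2 / 8 however many letters b follow; [k2] is so large that the masses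
   of Y and Z, at most c A^2 2^-k2 together, are below d S2. *)
exists (nseq n La ++ nseq (n + k2).+1 Lb ++ [:: Zero]).
eexists; eexists; split; first exact: (trial_startP n (n + k2) Ls (or_introl erefl)).
  rewrite -/S2; apply: le_trans S12; nra.
rewrite -/S2 -addnS halvesD -/A.
set e := halves R k2.+1.
have e0 : 0 < e := halves_gt0 R k2.+1; have e1 : e <= 1 := halves_le1 R k2.+1.
have ee : e <= rho * d ^+ 3 / 8.
  by apply: le_trans k2P; apply: halves_mono.
have S2le : c * A ^+ 2 * (rho * d ^+ 2 / 8) <= S2 by apply: le_trans S12; nra.
have : c * A ^+ 2 * e <= c * A ^+ 2 * (rho * d ^+ 3 / 8) by exact: ler_wpM2l.
have : c * A ^+ 2 * e ^+ 2 <= c * A ^+ 2 * e.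
  by rewrite ler_wpM2l // expr2 ler_piMl // ltW.
have : d * (c * A ^+ 2 * (rho * d ^+ 2 / 8)) <= d * S2.
  by apply: ler_wpM2l => //; rewrite ltW.
rewrite !exprS !expr0; nra.
Qed.

(** A trial leaves c' >= c - (1 + d) a, and (1 + d)(1 - d) <= 1, so the gain [a] pays for the later
    winnings that it removes, with a surplus of at least a q^N. *)
Lemma repeated_trials k (d := halves R k.+1) : exists2 q : R, 0 <= q < 1 &
  forall N L win c, trial_start L win c -> exists w,
    win + c * ((1 - d) * (1 - q ^+ N)) <= L (fm_prob w).
Proof.
have d0 : 0 < d := halves_gt0 R k.+1; have d1 : d <= 1 := halves_le1 R k.+1.
have [kappa kappa01 gain] := trial_gain k.
exists (1 - kappa); first by lra.
set q := 1 - kappa; have q01 : 0 <= q <= 1 by rewrite /q; lra.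
elim=> [|N IH] L win c Ls.
  exists [::]; rewrite fm_prob_pushes /= (mass_Win Ls.2) expr0; lra.
have [w [a [c' [Ls' ka cc']]]] := gain L win c Ls.
have [w' w'P] := IH _ _ _ Ls'.
exists (w ++ w'); rewrite fm_prob_pushes /pushes foldl_cat -/(pushes _ _) -fm_prob_pushes.
apply: le_trans w'P.
have c0 := trial_start_ge0 Ls.
have a0 : 0 <= a by apply: le_trans ka; rewrite mulr_ge0 //; lra.
have qN : 0 <= q ^+ N <= 1 by rewrite exprn_ge0 ?exprn_ile1; lra.
rewrite exprS; set r := q ^+ N in qN *.
have g0 : 0 <= (1 - d) * (1 - r) by rewrite mulr_ge0; lra.
have : (c - (1 + d) * a) * ((1 - d) * (1 - r)) <= c' * ((1 - d) * (1 - r)).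
  by rewrite ler_wpM2r.
have : kappa * c * r <= a * r by rewrite ler_wpM2r //; lra.
have : 0 <= a * d ^+ 2 * (1 - r) by rewrite !mulr_ge0 ?sqr_ge0 //; lra.
have : 0 <= kappa * c * r * d by rewrite !mulr_ge0 //; lra.
rewrite /q; lra.
Qed.

Lemma fm_prob_sup (m : M) (e : R) : 0 < e -> exists w, 1 - e <= fm_prob w m Start.
Proof.
move=> e0; have [k kP] : exists k, halves R k <= e / 2 by apply: halves_small; lra.
have kP' : halves R k.+1 <= e / 2 by apply: le_trans kP; exact: halves_mono.
have [q q01 trials] := repeated_trials k.
have [N NP] : exists N, q ^+ N <= e / 2 by apply: exp_vanishing => //; lra.
pose L0 : test -> R := fun f => f m Start.
have L0lin : pos_linear L0 by split=> // f g; exact.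
have L0M : masses L0 0 1 0 0 0 0 0 0.
  by split; rewrite /L0 /ind /unresolved !eqE.
have := masses_end L0lin L0M (or_introl erefl); rewrite !subr0 !addr0 => M1.
have [w wP] := trials N _ _ _ (conj (pos_linear_push Zero L0lin) M1).
(* The first [Zero] only sends the token from [Start] into a trial. *)
exists (Zero :: w); move: wP; rewrite fm_prob_cons /push /L0 => /(le_trans _); apply.
have := halves_gt0 R k.+1; have : 0 <= q ^+ N by rewrite exprn_ge0; lra.
rewrite add0r mul1r; nra.
Qed.

End FiniteMemory.

(** * Values *)

Section Values.
Variables (R : realType) (G : half_blind_game R).

Lemma prob_final_ge0 (s : S1 G) w tau : 0 <= prob_final s w tau.
Proof.
apply: sumr_ge0 => h _; rewrite /hist_prob; case: ifP => // _.
apply: prodr_ge0 => j _; case: (tnth _ _) => [[[s' a] t] b].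
by rewrite !mulr_ge0 ?fdist_ge0.
Qed.

Lemma maxmin_le_minmax (i : S1 G) : (maxmin_value i <= minmax_value i)%E.
Proof.
apply: ge_ereal_sup => _ [w _ <-]; apply: le_ereal_inf_tmp => _ [tau _ <-].
apply: le_trans (ereal_sup_ubound _); last by exists w.
by apply: ereal_inf_lbound; exists tau.
Qed.

(** A bound for pure words passes to mixed ones: every finite partial sum is at most r times a
    partial mass of [w]. *)
Lemma minmax_value_le (i : S1 G) tau (r : R) : 0 <= r ->
  (forall w, prob_final i w tau <= r) -> (minmax_value i <= r%:E)%E.
Proof.
move=> r0 taur; apply: ge_ereal_inf; eexists; first by exists tau.
apply: ge_ereal_sup => _ [w _ <-]; apply: ge_ereal_sup => _ [A finA <-].
have : (\sum_(v \in A) (w v)%:E <= 1)%E.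
  by rewrite -(mixed_word_sum1 w); apply: ereal_sup_ubound; exists A.
have [Afin _] := finA; rewrite !fsbig_finite //.
rewrite -!(big_morph EFin (fun _ _ => erefl) erefl) !lee_fin => w1.
apply: le_trans (ler_piMr r0 w1).
rewrite mulr_sumr; apply: ler_sum => v _.
by rewrite [leRHS]mulrC ler_wpM2l ?mixed_word_ge0.
Qed.

Lemma esum_dirac (T : choiceType) (v0 : T) (f : T -> R) :
  0 <= f v0 -> (\esum_(v in [set: T]) ((v == v0)%:R * f v)%:E = (f v0)%:E)%E.
Proof.
move=> f0; rewrite -(@esum_set1 R T v0 (fun v => (f v)%:E)) ?lee_fin //.
rewrite [RHS]esum_mkcond; apply: eq_esum => v _.
case: (eqVneq v v0) => [->|/eqP ne]; first by rewrite mem_set // mul1r.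
by rewrite memNset // mul0r.
Qed.

Lemma dirac_word_sum1 (w : seq (A1 G)) :
  (\esum_(v in [set: seq (A1 G)]) ((v == w)%:R : R)%:E = 1)%E.
Proof.
rewrite -[RHS](@esum_dirac _ w (fun=> 1)) //.
by apply: eq_esum => v _; rewrite mulr1.
Qed.

Definition dirac_word (w : seq (A1 G)) : mixed_word G :=
  MixedWord (fun v => ler0n _ (v == w)) (dirac_word_sum1 w).

Lemma maxmin_value_ge (i : S1 G) w (r : R) :
  (forall tau, r <= prob_final i w tau) -> (r%:E <= maxmin_value i)%E.
Proof.
move=> wr; apply: le_ereal_sup_tmp; eexists; first by exists (dirac_word w).
apply: le_ereal_inf_tmp => _ [tau _ <-].
by rewrite /prob_final_mixed esum_dirac ?prob_final_ge0 // lee_fin.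
Qed.

(** Every transducer yields the supremum 1; the given transducer keeps the infimum from being over
    the empty set. *)
Lemma finite_memory_value1 (i : S1 G) : transducer G ->
  (forall T w, prob_final_fm i w T <= 1) ->
  (forall T (e : R), 0 < e -> exists w, 1 - e <= prob_final_fm i w T) ->
  finite_memory_value i = 1%E.
Proof.
move=> T0 le1 ge1.
have sup1 T : ereal_sup (range (fun w : seq (A1 G) => (prob_final_fm i w T)%:E)) = 1%E.
  apply/eqP; rewrite eq_le; apply/andP; split.
    by apply: ge_ereal_sup => _ [w _ <-]; rewrite lee_fin.
  apply/lee_addgt0Pr => e e0; have [w wP] := ge1 T e e0.
  rewrite -leeBlDr //; apply: le_trans (ereal_sup_ubound _); last by exists w.
  by rewrite lee_fin.
rewrite /finite_memory_value (_ : [set _ | _]%classic = [set 1%E]%classic) ?ereal_inf1 //.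
by apply/seteqP; split=> [x [T ->]|x ->] /=; [exact: sup1|exists T0].
Qed.

End Values.

(** The first [One] puts the token on Y with probability 1/2, and the second wins there before the
    minimizer has any choice. *)
Lemma prob_final_One_One (R : realType) (tau : strategy2 (game R)) :
  2^-1 <= prob_final (Start : S1 (game R)) [:: One : A1 (game R); One] tau.
Proof.
rewrite prob_final_cons /= /split !expect_mixture !expect_dirac.
have expect_ge0 f t : (forall b, 0 <= f b) -> 0 <= expect (tau [::] Start One t) f.
  by move=> f0; apply: sumr_ge0 => b _; rewrite mulr_ge0 ?fdist_ge0.
have Y1 tau' : prob_final (Y false : S1 (game R)) [:: One : A1 (game R)] tau' = 1.
  rewrite prob_final_cons /= expect_dirac -[RHS](expect_cst
    (tau' [::] (Y false) One Win)).
  by apply: eq_expect => b; rewrite prob_final_nil.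
under eq_expect do rewrite Y1.
rewrite expect_cst mulr1 lerDl.
apply: mulr_ge0; first lra.
apply: addr_ge0; apply: mulr_ge0; try lra;
  by apply: expect_ge0 => b; exact: prob_final_ge0.
Qed.

Theorem theorem9 (R : realType) :
  exists (G : half_blind_game R) (i : S1 G),
    [/\ maxmin_value i = (2^-1)%:E,
        minmax_value i = (2^-1)%:E,
        (maxmin_value i < finite_memory_value i)%E
      & finite_memory_value i = 1%:E].
Proof.
exists (game R), Start.
have maxmin_ge := maxmin_value_ge (@prob_final_One_One R).
have minmax_le : (minmax_value (Start : S1 (game R)) <= (2^-1)%:E)%E.
  apply: (@minmax_value_le _ _ _ (counting_strategy (0, 0)%N)) => [|w].
    by rewrite invr_ge0.
  exact: (counting_prob_le R w).1.
have maxmin_le := maxmin_le_minmax (Start : S1 (game R)).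
have fm1 : finite_memory_value (Start : S1 (game R)) = 1%:E.
  apply: finite_memory_value1 => [|T w|T e e0].
  - exact: (@Transducer _ (game R) unit tt (fun _ _ => fdirac R tt) (fun=> fdirac R true)).
  - by have /andP[] := @fm_prob_bound R T w (init_memory T) Start.
  - exact: (@fm_prob_sup R T (init_memory T)).
have maxminE : maxmin_value (Start : S1 (game R)) = (2^-1)%:E.
  by apply/eqP; rewrite eq_le maxmin_ge (le_trans maxmin_le).
split=> //; first by apply/eqP; rewrite eq_le minmax_le (le_trans maxmin_ge).
rewrite fm1 maxminE lte_fin; lra.
Qed.
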